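(* Let $(W,S)$ be a finite Coxeter system with longest element $\omega_\circ$. The following two statements are equivalent. (a) The function $w\mapsto q^{|w|}$ is positive definite on $W$ for every $0\le q\le 1$. (b) The function $\Delta(w)=|\omega_\circ|/2-|w|$ is positive definite on $W$.
   Context: A Coxeter system $(W,S)$ is a group $W$ with generating set $S$ and presentation $W=\langle S\mid (s_1s_2)^{m(s_1,s_2)}=1 \text{ whenever } m(s_1,s_2)\neq\infty\rangle$, where $m\colon S\times S\to\{1,2,\dots,\infty\}$ is symmetric and $m(s_1,s_2)=1$ iff $s_1=s_2$. $|w|$ is the word length of $w\in W$ with respect to $S$; if $W$ is finite, $\omega_\circ$ denotes the unique element of maximal length. A function $\varphi\colon W\to\mathbb{C}$ is positive definite if $\sum_{x,y\in W}\varphi(y^{-1}x)\alpha(x)\overline{\alpha(y)}\ge 0$ for every finitely supported $\alpha\colon W\to\mathbb{C}$. Convention: $0^0=1$. *)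

(* Defs.v *)
From HB Require Import structures.
From mathcomp Require Import all_boot all_order all_fingroup all_algebra.
From mathcomp Require Import reals complex.

Set Implicit Arguments.
Unset Strict Implicit.
Unset Printing Implicit Defensive.

Import Order.TTheory GRing.Theory Num.Theory.

Section CoxeterSystem.
Local Open Scope group_scope.

Variables (gT : finGroupType) (S : {set gT}).

Definition generator : finType := {s : gT | s \in S}.

(* The letter (s, false) stands for s, and (s, true) for its formal inverse. *)
Definition word := seq (generator * bool).

Definition letter_val (l : generator * bool) : gT :=
  if l.2 then (val l.1)^-1 else val l.1.

Definition word_val (u : word) : gT := \prod_(l <- u) letter_val l.

(* Equality in the free group on S modulo the normal closure of the words
   satisfying R. *)
Inductive word_equiv (R : word -> Prop) : word -> word -> Prop :=
| word_equiv_refl u : word_equiv R u u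
| word_equiv_sym u v : word_equiv R u v -> word_equiv R v u
| word_equiv_trans u v w :
    word_equiv R u v -> word_equiv R v w -> word_equiv R u w
| word_equiv_cancel u v s b :
    word_equiv R (u ++ [:: (s, b); (s, ~~ b)] ++ v) (u ++ v)
| word_equiv_relator u v r : R r -> word_equiv R (u ++ r ++ v) (u ++ v).

(* The whole group gT is < S | r = 1 for r satisfying R >. *)
Definition presented_by (R : word -> Prop) : Prop :=
  <<S>> = [set: gT] /\
  forall u v : word, word_val u = word_val v <-> word_equiv R u v.

(* In m s t : option nat, None encodes infinity. *)
Definition coxeter_matrix (m : generator -> generator -> option nat) : Prop :=
  [/\ forall s t, m s t = m t s,
      forall s t, m s t <> Some 0%N
    & forall s t, m s t = Some 1%N <-> s = t].

Definition coxeter_relator (m : generator -> generator -> option nat)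
    (r : word) : Prop :=
  exists s t n,
    m s t = Some n /\ r = flatten (nseq n [:: (s, false); (t, false)]).

Definition coxeter_system : Prop :=
  exists m : generator -> generator -> option nat,
    coxeter_matrix m /\ presented_by (coxeter_relator m).

(* S ^+ n is the set of products of n elements of S. *)
Lemma gen_expg_ex (w : gT) : w \in <<S>> -> exists n, w \in S ^+ n.
Proof.
move=> /gen_prodgP[n [c Sc ->]]; exists n.
elim: n c Sc => [|n IHn] c Sc; first by rewrite big_ord0 expg0 inE.
by rewrite big_ord_recl expgS mem_mulg // IHn.
Qed.

(* Least number of factors in an expression of w as a product of elements of S.
   Formal inverses are not needed, since the elements of S in a Coxeter system
   are involutions. The value 0 outside of <<S>> is a dummy. *)
Definition wlength (w : gT) : nat :=
  if @idP (w \in <<S>>) is ReflectT Sw then ex_minn (gen_expg_ex Sw) else 0%N.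

Definition longest (w : gT) : Prop := forall x, (wlength x <= wlength w)%N.

End CoxeterSystem.

Local Open Scope ring_scope.

(* On R[i], 0 <= z means that z is real and nonnegative. *)
Definition positive_definite (R : realType) (gT : finGroupType)
    (phi : gT -> R[i]) : Prop :=
  forall a : gT -> R[i],
    0 <= \sum_(x : gT) \sum_(y : gT)
           phi (y^-1 * x)%g * a x * Num.conj (a y).

(* Main.v *)
Require Import Defs.
From mathcomp Require Import all_boot all_order all_fingroup all_algebra.
From mathcomp Require Import reals complex.
From mathcomp Require Import ring lra.

(** Both statements hold for every finite Coxeter system, for the same geometric
reason. Every reflection [r] has a wall that cuts the group into two halves,
and [|y^-1 x|] is the number of walls separating [x] from [y]. Let
[side r x] be [1] or [-1] according to the side of the wall of [r] that
contains [x]. Then [side r x * side r y] is [-1] if the wall of [r] separates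
[x] from [y] and [1] otherwise, so

- [q ^ |y^-1 x|] is the product over [r] of
  [(1 + q) / 2 + (1 - q) / 2 * side r x * side r y]. For [0 <= q <= 1],
  expanding it gives a combination, with nonnegative coefficients, of kernels
  [f x * f y] with [f] a product of functions [side r];
- all walls separate [w0] from [1], so [|w0|] is the number of reflections, and
  [|w0| / 2 - |y^-1 x|] is the sum over [r] of [side r x * side r y / 2].

A nonnegative combination of kernels [f x * f y], with [f] real, is positive
definite, because each of them contributes a squared modulus.

The group theory behind the count of walls is obtained from the presentation.
For a word [s_1 ... s_k], the parity of the number of [i] such that
[r = s_1 ... s_(i-1) s_i s_(i-1) ... s_1] does not change under the relations
([word_equiv_wall_parity]), so it depends only on the element represented. With
the exchange property ([wall_parity_exchange]), this parity detects whether
[|r w| < |w|] ([left_inversions_wall_parity]). It follows that the left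
inversions form a cocycle ([left_inversionsM]), that an element has as many of
them as its length ([card_left_inversions]), and that every reflection is a
left inversion of the longest element ([longest_left_inversions]). *)

Set Implicit Arguments.
Unset Strict Implicit.
Unset Printing Implicit Defensive.

Import Order.TTheory GRing.Theory Num.Theory.

(** * Parity of wall crossings along a word *)

Section Words.
Local Open Scope group_scope.
Variable gT : finGroupType.
Implicit Types (s t r x y : gT) (u v : seq gT).

(** The word [s_1 ... s_k] is read as the gallery [1, s_1, s_1 s_2, ...]. Its
[i]-th step crosses the wall of [s_1 ... s_(i-1) s_i s_(i-1) ... s_1] (for
letters that are involutions). The value is the parity of the number of steps
that cross the wall of [r]. *)
Fixpoint wall_parity u r : bool :=
  if u is s :: v then (r == s) (+) wall_parity v (r ^ s) else false.

Lemma wall_parity_cat u v r :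
  wall_parity (u ++ v) r
    = wall_parity u r (+) wall_parity v (r ^ \prod_(s <- u) s).
Proof.
elim: u r => [|s u IHu] r /=; first by rewrite big_nil conjg1.
by rewrite IHu big_cons conjgM addbA.
Qed.

(** The prefix of length [i + 1] of an alternating word, followed by the
reversed prefix of length [i], is the alternating word of length [2 i + 1],
which is [(s * t) ^+ i * s]. *)
Lemma wall_parity_alternating s t n r : s * s = 1 -> t * t = 1 ->
  wall_parity (flatten (nseq n [:: s; t])) r
    = \big[addb/false]_(0 <= i < n.*2) (r == (s * t) ^+ i * s).
Proof.
move=> ss tt; have sV : s^-1 = s by apply/eqP; rewrite eq_invg_mul ss.
have tV : t^-1 = t by apply/eqP; rewrite eq_invg_mul tt.
elim: n r => [|n IHn] r; first by rewrite big_geq.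
rewrite doubleS 2?big_nat_recl //= IHn expg0 mul1g expg1.
rewrite (can2_eq (conjgK s) (conjgKV s)) conjgE invgK sV.
congr (_ (+) (_ (+) _)).
  by rewrite mulgA.
apply: eq_bigr => i _.
rewrite -conjgM (can2_eq (conjgK (s * t)) (conjgKV (s * t))) conjgE invgK.
by rewrite invMg sV tV expgS expgSr -!mulgA.
Qed.

(** In the list of the [n.*2] elements [(s * t) ^+ i * s], the terms of index
[i] and [i + n] are equal, so each element occurs an even number of times. *)
Lemma wall_parity_braid s t n r : s * s = 1 -> t * t = 1 ->
  (s * t) ^+ n = 1 -> wall_parity (flatten (nseq n [:: s; t])) r = false.
Proof.
move=> ss tt st_n; rewrite wall_parity_alternating // -addnn.
rewrite (@big_cat_nat _ _ _ n) ?leq_addr //= -{2}[n]add0n big_addn addnK.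
rewrite [X in _ (+) X](eq_bigr (fun i => r == (s * t) ^+ i * s)) ?addbb //.
by move=> i _; rewrite expgD st_n mulg1.
Qed.

(** If the path crosses the wall of [r], then reflecting the part of the path
beyond a crossing amounts to deleting a letter. *)
Lemma wall_parity_exchange u r :
  (forall s, s \in u -> s * s = 1) -> wall_parity u r ->
  exists v, [/\ subseq v u, size v < size u
              & \prod_(s <- v) s = r * \prod_(s <- u) s].
Proof.
elim: u r => //= s u IHu r sq; case: eqP => [-> _|_].
  have ss : s * s = 1 := sq s (mem_head s u).
  exists u; rewrite ltnSn big_cons mulgA ss mul1g; split=> //.
  exact: subseq_cons.
case/IHu=> [x xu|v [vu sz_v vE]]; first by apply: sq; rewrite inE xu orbT.
exists (s :: v); rewrite ltnS !big_cons vE; split=> //.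
  by rewrite /= eqxx.
by rewrite conjgE !mulgA mulgV mul1g.
Qed.

(** The step [s] inserted after [u] crosses the wall of [r]. It does not change
the other crossings of that wall, since [s] is conjugate to itself by [s]. *)
Lemma wall_parity_reflection u v s r : wall_parity (u ++ v) =1 xpred0 ->
  r ^ (\prod_(x <- u) x) = s -> wall_parity (u ++ s :: v) r.
Proof.
move=> uv0 rE; have := uv0 r; rewrite !wall_parity_cat /= rE eqxx.
by rewrite conjgE mulKg; case: (wall_parity u r); case: (wall_parity v s).
Qed.
End Words.

(** * Inversions in a finite Coxeter system *)

Section Inversions.
Local Open Scope group_scope.
Variables (gT : finGroupType) (S : {set gT}).
Hypothesis hS : coxeter_system S.
Implicit Types (s t r w x y : gT) (u v : seq gT).

Local Notation letters := (map (@letter_val gT S)).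

Lemma relator_equiv_nil (R : word S -> Prop) (p : word S) :
  R p -> word_equiv R p [::].
Proof.
by move=> Rp; have := word_equiv_relator [::] [::] Rp; rewrite /= cats0.
Qed.

Lemma generated_by_generators w : w \in <<S>>.
Proof. by case: hS => m [_ [-> _]]; rewrite inE. Qed.

Lemma generator_sq s : s \in S -> s * s = 1.
Proof.
case: hS => m [[_ _ m1] [_ pres]] Ss.
pose g : generator S := Sub s Ss.
have: word_val [:: (g, false); (g, false)] = word_val (nil : word S).
  apply/pres; apply: relator_equiv_nil.
  by exists g, g, 1%N; split=> //; apply/m1.
by rewrite /word_val !big_cons big_nil /letter_val /= mulg1.
Qed.

Lemma generatorV s : s \in S -> s^-1 = s.
Proof. by move/generator_sq=> ss; apply/eqP; rewrite eq_invg_mul ss. Qed.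

(** This is where the presentation is used. By [wall_parity_cat], a factor that
represents [1] and crosses each wall an even number of times can be inserted
anywhere; the cancelling pairs and the braid relators are such factors. *)
Lemma word_equiv_wall_parity m (p q : word S) :
  presented_by (coxeter_relator m) -> word_equiv (coxeter_relator m) p q ->
  wall_parity (letters p) =1 wall_parity (letters q).
Proof.
move=> [_ pres].
have insertion (p1 p2 p3 : word S) :
    wall_parity (letters p2) =1 xpred0 -> word_val p2 = 1 ->
    wall_parity (letters (p1 ++ p2 ++ p3)) =1 wall_parity (letters (p1 ++ p3)).
  move=> par0 val1 r; rewrite !map_cat !wall_parity_cat par0 addFb.
  by rewrite !big_map; move: val1; rewrite /word_val => ->; rewrite conjg1.
elim=> {p q} [p|p q _ IH|p q v _ IH1 _ IH2|p q s b|p q v Rv] r //.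
- by rewrite IH1.
- have ss := generator_sq (valP s).
  have lE c : letter_val (s, c) = val s.
    by case: c; rewrite /letter_val //= generatorV ?(valP s).
  apply: insertion => [r'|]; last first.
    by rewrite /word_val !big_cons big_nil !lE mulg1.
  rewrite /= !lE addbF (can2_eq (conjgK (val s)) (conjgKV (val s))) conjgE.
  by rewrite invgK mulgV mulg1 addbb.
have v1 : word_val v = word_val (nil : word S).
  by apply/pres; apply: relator_equiv_nil.
apply: insertion => [r'|]; last by rewrite v1 /word_val big_nil.
have [s [t [n [_ vE]]]] := Rv.
rewrite vE map_flatten map_nseq /= wall_parity_braid //.
- exact: generator_sq (valP s).
- exact: generator_sq (valP t).
move: v1; rewrite vE /word_val big_nil => <-.
elim: (n) => [|k IHk]; first by rewrite big_nil.
by rewrite /= expgS IHk !big_cons mulgA.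
Qed.

Lemma wall_parity_prod u v : {subset u <= S} -> {subset v <= S} ->
  \prod_(s <- u) s = \prod_(s <- v) s -> wall_parity u =1 wall_parity v.
Proof.
have lift (u0 : seq gT) : {subset u0 <= S} ->
    exists p : word S, letters p = u0.
  elim: u0 => [|s u0 IH] Su0; first by exists [::].
  have [x xu0|p pE] := IH; first by apply: Su0; rewrite inE xu0 orbT.
  have Ss : s \in S by apply: Su0; rewrite mem_head.
  by exists ((Sub s Ss : generator S, false) :: p); rewrite /= pE.
move=> /lift[p <-] /lift[q <-]; rewrite !big_map.
case: hS => m [_ pres] /(proj2 pres); exact: word_equiv_wall_parity.
Qed.

Lemma wlength_prod u : {subset u <= S} ->
  (wlength S (\prod_(s <- u) s) <= size u)%N.
Proof.
move=> Su; rewrite /wlength; case: {-}_ / idP => [Sw|//].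
case: ex_minnP => n _; apply.
elim: u Su {Sw} => [|s u IH] Su; first by rewrite big_nil expg0 inE.
rewrite big_cons /= expgS mem_mulg ?IH ?Su ?mem_head // => x xu.
by apply: Su; rewrite inE xu orbT.
Qed.

Lemma reduced_word w : exists u,
  [/\ {subset u <= S}, \prod_(s <- u) s = w & size u = wlength S w].
Proof.
rewrite /wlength; case: {-}_ / idP => [Sw|]; last first.
  by rewrite generated_by_generators.
case: ex_minnP => n + _; elim: n w {Sw} => [|n IH] w.
  by rewrite expg0 inE => /eqP->; exists [::]; rewrite big_nil.
rewrite expgS => /mulsgP[s x Ss /IH[u [Su <- <-]] ->].
exists (s :: u); rewrite big_cons; split=> // y; rewrite inE => /predU1P[->//|].
exact: Su.
Qed.

Definition reflections : {set gT} := class_support S [set: gT].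

Lemma reflectionsJ r x : (r ^ x \in reflections) = (r \in reflections).
Proof.
by rewrite memJ_norm // (subsetP (class_support_norm S [set: gT]%G)) ?in_setT.
Qed.

Lemma reflection_sq r : r \in reflections -> r * r = 1.
Proof. by case/imset2P=> s x Ss _ ->; rewrite -conjMg generator_sq ?conj1g. Qed.

Lemma reflection_word r : r \in reflections ->
  exists u, [/\ {subset u <= S}, \prod_(s <- u) s = r & wall_parity u r].
Proof.
case/imset2P=> s x Ss _ rE.
have [v [Sv vE _]] := reduced_word x^-1.
have [v' [Sv' v'E _]] := reduced_word x.
exists (v ++ s :: v'); split.
- by move=> y; rewrite !mem_cat inE => /or3P[/Sv//|/eqP->//|/Sv'].
- by rewrite big_cat big_cons /= vE v'E rE conjgE.
apply: wall_parity_reflection; last by rewrite vE rE -conjgM mulgV conjg1.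
apply: (wall_parity_prod (v := [::])) => //; last first.
  by rewrite big_cat big_nil /= vE v'E mulVg.
by move=> y; rewrite mem_cat => /orP[/Sv|/Sv'].
Qed.

Definition left_inversions w : {set gT} :=
  [set r in reflections | wlength S (r * w) < wlength S w]%N.

(** An odd parity yields a shorter word for [r * w] by exchange in a reduced
word of [w]. If the parity is even, the path of [r * w] that starts with a word
for [r] crosses the wall of [r] an odd number of times, so the first case
applies to [r * w] and says that [w] is shorter than [r * w]. *)
Lemma left_inversions_wall_parity u r : {subset u <= S} ->
  (r \in left_inversions (\prod_(s <- u) s)) = wall_parity u r.
Proof.
have odd_inversion v t : {subset v <= S} -> wall_parity v t ->
    t \in left_inversions (\prod_(s <- v) s).
  move=> Sv odd_t; rewrite inE; apply/andP; split.
    elim: v t Sv odd_t => //= s v IH t Ssv.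
    have Ss : s \in S by apply: Ssv; rewrite mem_head.
    case: eqP => [-> _|_ /IH].
      by rewrite -[s]conjg1 memJ_class_support ?inE.
    rewrite reflectionsJ; apply=> x xv.
    by apply: Ssv; rewrite inE xv orbT.
  have [v' [Sv' v'E sz_v']] := reduced_word (\prod_(s <- v) s).
  rewrite -(wall_parity_prod Sv' Sv v'E) in odd_t.
  have sq s : s \in v' -> s * s = 1 by move/Sv'/generator_sq.
  have [v2 [/mem_subseq v2_v' sz_v2 v2E]] := wall_parity_exchange sq odd_t.
  rewrite -v'E -v2E v'E -sz_v'; apply: leq_ltn_trans sz_v2.
  by apply: wlength_prod => s /v2_v'/Sv'.
move=> Su; apply/idP/idP => [|/odd_inversion->//].
rewrite inE => /andP[Tr lt_ru]; apply/negPn/negP => even_r.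
have [p [Sp pE par_r]] := reflection_word Tr.
have par_pu : wall_parity (p ++ u) r.
  by rewrite wall_parity_cat par_r pE conjgE mulKg (negPf even_r).
have Spu : {subset p ++ u <= S} by move=> y; rewrite mem_cat => /orP[/Sp|/Su].
have := odd_inversion _ _ Spu par_pu.
rewrite big_cat pE inE mulgA reflection_sq // mul1g => /andP[_].
by rewrite ltnNge ltnW.
Qed.

Lemma left_inversionsM x y r :
  (r \in left_inversions (x * y))
    = (r \in left_inversions x) (+) (r ^ x \in left_inversions y).
Proof.
have [u [Su <- _]] := reduced_word x; have [v [Sv <- _]] := reduced_word y.
have Suv : {subset u ++ v <= S} by move=> s; rewrite mem_cat => /orP[/Su|/Sv].
rewrite -big_cat !left_inversions_wall_parity //; exact: wall_parity_cat.
Qed.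

(** Prepending [s] to a word of [w] conjugates its walls by [s] and adds the wall
of [s]. If the resulting word is reduced, then this wall is new: otherwise
[s * w] would be shorter than [w]. *)
Lemma card_left_inversions w : #|left_inversions w| = wlength S w.
Proof.
have [u [Su <- sz_u]] := reduced_word w.
rewrite -sz_u; elim: u {w} Su sz_u => [|s u IH] Ssu; rewrite ?big_cons => sz_u.
  apply/eqP; rewrite cards_eq0; apply/eqP/setP => r.
  by rewrite left_inversions_wall_parity ?inE.
have Ss : s \in S by apply: Ssu; rewrite mem_head.
have Su : {subset u <= S} by move=> x xu; apply: Ssu; rewrite inE xu orbT.
have red_u : size u = wlength S (\prod_(x <- u) x).
  apply/eqP; rewrite eqn_leq wlength_prod // andbT.
  have [v [Sv vE <-]] := reduced_word (\prod_(x <- u) x).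
  have Ssv : {subset s :: v <= S}.
    by move=> x; rewrite inE => /predU1P[->//|]; exact: Sv.
  by have := wlength_prod Ssv; rewrite big_cons vE -sz_u.
have s_notin : s \notin left_inversions (\prod_(x <- u) x).
  rewrite inE negb_and -leqNgt -red_u orbC.
  by rewrite -sz_u leqW.
rewrite /= -(IH Su red_u) -(cardJg _ s^-1).
rewrite (_ : left_inversions (s * _)
             = s |: left_inversions (\prod_(x <- u) x) :^ s^-1).
  by rewrite cardsU1 mem_conjgV conjgE mulKg s_notin.
have inv_s r : (r \in left_inversions s) = (r == s).
  have := @left_inversions_wall_parity [:: s] r.
  by rewrite big_seq1 /= addbF; apply=> x; rewrite inE => /eqP->.
apply/setP=> r; rewrite left_inversionsM inv_s in_setU1 mem_conjgV.
by case: eqP => [->|//]; rewrite conjgE mulKg (negPf s_notin).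
Qed.

(** If [r] is not a left inversion of [w], then it is one of [r * w], which is
therefore longer than [w]. *)
Lemma longest_left_inversions w :
  longest S w -> left_inversions w = reflections.
Proof.
move=> w_max; apply/setP=> r; rewrite inE andb_idr // => Tr.
have : r \in left_inversions (r * w) = (r \notin left_inversions w).
  have [u [Su <- par_u]] := reflection_word Tr.
  by rewrite left_inversionsM left_inversions_wall_parity // par_u conjgE mulKg.
rewrite !inE mulgA reflection_sq // mul1g Tr /= ltnNge w_max /=.
by move/esym/negbFE.
Qed.

Definition separating x y : {set gT} :=
  [set r | (r \in left_inversions x) (+) (r \in left_inversions y)].

(** Left translation by [y^-1] carries a walk from [y] to [x] to one from [1] to
[y^-1 * x]. It conjugates reflections by [y]; by the cocycle relation, this maps
[separating x y] onto the left inversions of [y^-1 * x]. *)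
Lemma card_separating x y : #|separating x y| = wlength S (y^-1 * x).
Proof.
rewrite -card_left_inversions -(cardJg (separating x y) y).
apply: eq_card => r; rewrite mem_conjg inE -{1}(mulKVg y x) left_inversionsM.
by rewrite conjgKV addbC addbA addbb.
Qed.

Lemma separating_sub x y : separating x y \subset reflections.
Proof. by apply/subsetP=> r; rewrite !inE; case: (r \in reflections). Qed.
End Inversions.

(** * Positive definite kernels from the sides of the walls *)

Section PositiveDefinite.
Local Open Scope ring_scope.
Local Open Scope complex_scope.
Variables (R : realType) (gT : finGroupType).

(** With [z i = \sum_x f i x * a x], the quadratic form of [phi] at [a] is the
sum of the [c i * |z i| ^ 2]. *)
Lemma positive_definite_sum_squares (I : finType) (c : I -> R)
    (f : I -> gT -> R) (phi : gT -> R[i]) :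
  (forall i, 0 <= c i) ->
  (forall x y, phi (y^-1 * x)%g = (\sum_i c i * (f i x * f i y))%:C) ->
  positive_definite phi.
Proof.
move=> c_ge0 phiE a; pose z i := \sum_x (f i x)%:C * a x.
rewrite [leRHS](_ : _ = \sum_i (c i)%:C * (z i * Num.conj (z i))).
  by apply: sumr_ge0 => i _; rewrite mulr_ge0 ?mul_conjC_ge0 // lecR.
under [RHS]eq_bigr => i _.
  rewrite rmorph_sum mulr_suml mulr_sumr.
  under eq_bigr => x _ do rewrite !mulr_sumr.
  over.
rewrite [RHS]exchange_big; apply: eq_bigr => x _.
rewrite [RHS]exchange_big; apply: eq_bigr => y _ /=.
rewrite phiE rmorph_sum !mulr_suml; apply: eq_bigr => i _.
rewrite !rmorphM /= (_ : Num.conj (f i y)%:C = (f i y)%:C); last first.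
  by rewrite conj_Creal // complex_real.
ring.
Qed.

Variable (S : {set gT}).
Hypothesis hS : coxeter_system S.

Definition side (r x : gT) : R := (-1) ^+ (r \in left_inversions S x).

Lemma sideM r x y : side r x * side r y = (-1) ^+ (r \in separating S x y).
Proof. by rewrite inE signr_addb. Qed.

Lemma positive_definite_length_exp (q : R) : 0 <= q <= 1 ->
  positive_definite (fun w : gT => (q ^+ wlength S w)%:C).
Proof.
(* [p + m = 1] and [p - m = q] are the factors of a non-separating and of a
   separating wall; [J] is the set of the factors in which [p] is picked. An [r]
   that is not a reflection separates nothing and contributes a factor 1. *)
move=> /andP[q0 q1]; pose p := (1 + q) / 2; pose m := (1 - q) / 2.
pose c (J : {set gT}) := \prod_r (if r \in J then p else m).
pose f (J : {set gT}) x := \prod_r (if r \in J then 1 else side r x).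
apply: (@positive_definite_sum_squares _ c f) => [J|x y].
  by apply: prodr_ge0 => r _; case: ifP => _; rewrite /p /m; lra.
congr _%:C; rewrite -card_separating //.
transitivity (\prod_r (p + m * (side r x * side r y))).
  rewrite -prodr_const [RHS](bigID (mem (separating S x y))) /=.
  rewrite [X in _ * X]big1 ?mulr1.
    by apply: eq_bigr => r xyr; rewrite sideM xyr /p /m; field.
  by move=> r xyr; rewrite sideM (negPf xyr) /p /m; field.
rewrite bigA_distr; apply: eq_big => // J _; rewrite -!big_split /=.
by apply: eq_bigr => r _; case: ifP => _; rewrite ?mulr1.
Qed.

Lemma positive_definite_centered_length w0 : longest S w0 ->
  positive_definite
    (fun w : gT => ((wlength S w0)%:R / 2 - (wlength S w)%:R : R)%:C).
Proof.
move=> w0_max.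
pose c r : R := (r \in reflections S)%:R / 2.
apply: (@positive_definite_sum_squares _ c side) => [r|x y].
  by rewrite divr_ge0.
congr _%:C; rewrite -card_separating // -card_left_inversions //.
rewrite longest_left_inversions //.
have cardR (A : {set gT}) : #|A|%:R = \sum_r (r \in A)%:R :> R.
  by rewrite -sum1_card natr_sum big_mkcond; apply: eq_bigr => r _; case: ifP.
rewrite !cardR mulr_suml -sumrB; apply: eq_bigr => r _; rewrite sideM.
have := subsetP (separating_sub S x y) r.
rewrite /c; case: (r \in separating S x y) => [->//|_]; first by field.
by case: (r \in reflections S) => /=; field.
Qed.
End PositiveDefinite.

Local Open Scope ring_scope.
Local Open Scope complex_scope.

Theorem proposition5p1 (R : realType) (gT : finGroupType) (S : {set gT})
    (w0 : gT) (hS : coxeter_system S) (hw0 : longest S w0) :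
  (forall q : R, 0 <= q <= 1 ->
     positive_definite (fun w : gT => (q ^+ wlength S w)%:C)) <->
  positive_definite
    (fun w : gT => ((wlength S w0)%:R / 2 - (wlength S w)%:R : R)%:C).
Proof.
split=> _.
  exact: positive_definite_centered_length.
by move=> q; exact: positive_definite_length_exp.
Qed.
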